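(* Let $2<n<\omega$. Let $T$ be a complete countable $L_n$ theory that has quantifier elimination, let $\lambda<2^\omega$ be a cardinal, and let $\mathbf X=(X_i:i<\lambda)$ be a family of non-principal complete types of $T$. Then there is a countable model of $T$ that omits $\mathbf X$, i.e. omits every $X_i$, $i<\lambda$.
   Context: $L_n$ is first-order logic (with equality) restricted to the first $n$ variables $x_0,\dots,x_{n-1}$. $T$ has quantifier elimination if every first-order formula in the signature of $T$ is equivalent modulo $T$ to a quantifier-free formula with the same free variables (allowing the constants true and false for sentences). A type of $T$ is a set of $L_n$-formulas. It is complete if it corresponds to a (Boolean) ultrafilter of the Tarski–Lindenbaum algebra $\mathfrak{Fm}_T$ of $L_n$-formulas modulo $T$-equivalence. It is non-principal if the infimum of the corresponding subset of $\mathfrak{Fm}_T$ is $0$, i.e. it is not isolated by a formula consistent with $T$. A model omits a type if no assignment satisfies all formulas of the type simultaneously. *)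

(* Defs.v *)
From HB Require Import structures.
From mathcomp Require Import all_boot all_order.
From mathcomp Require Import generic_quotient.
From mathcomp Require Import boolp classical_sets functions cardinality.
Set Implicit Arguments.
Unset Strict Implicit.
Unset Printing Implicit Defensive.

Import Order.TTheory.
Local Open Scope quotient_scope.
Local Open Scope classical_set_scope.
Local Open Scope card_scope.

Record signature := Signature {
  func : Type;
  pred_sym : Type;
  far : func -> nat;
  par : pred_sym -> nat
}.

(* Formulas are parametrized by the type V of variables: V := nat gives full
   first-order logic over x_0, x_1, x_2, ..., and V := 'I_n gives L_n, in which
   only x_0, ..., x_{n-1} may occur, free or bound. *)
Inductive term (S : signature) (V : Type) : Type :=
| Var of V
| App (f : func S) of ('I_(far f) -> term S V).

Inductive formula (S : signature) (V : Type) : Type :=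
| Bot
| Eq of term S V & term S V
| Pred (p : pred_sym S) of ('I_(par p) -> term S V)
| Not of formula S V
| And of formula S V & formula S V
| Ex of V & formula S V.

Arguments Bot {S V}.

Definition Top {S V} : formula S V := Not Bot.
Definition Or {S V} (phi psi : formula S V) := Not (And (Not phi) (Not psi)).

Section Syntax.
Variables (S : signature) (V : Type).

Fixpoint term_vars (t : term S V) : set V :=
  match t with
  | Var x => [set x]
  | App f a => \bigcup_(i in [set: 'I_(far f)]) term_vars (a i)
  end.

Fixpoint free_vars (phi : formula S V) : set V :=
  match phi with
  | Bot => set0
  | Eq t u => term_vars t `|` term_vars u
  | Pred p a => \bigcup_(i in [set: 'I_(par p)]) term_vars (a i)
  | Not phi => free_vars phi
  | And phi psi => free_vars phi `|` free_vars psi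
  | Ex x phi => free_vars phi `\ x
  end.

Definition sentence (phi : formula S V) := free_vars phi = set0.

Fixpoint quantifier_free (phi : formula S V) : bool :=
  match phi with
  | Bot | Eq _ _ | Pred _ _ => true
  | Not phi => quantifier_free phi
  | And phi psi => quantifier_free phi && quantifier_free psi
  | Ex _ _ => false
  end.

End Syntax.

Record structure (S : signature) := Structure {
  carrier :> Type;
  carrier_inhabited : inhabited carrier;
  interp_func : forall f : func S, ('I_(far f) -> carrier) -> carrier;
  interp_pred : forall p : pred_sym S, ('I_(par p) -> carrier) -> Prop
}.

Section Semantics.
Variables (S : signature) (V : eqType).

Definition update (A : Type) (s : V -> A) (x : V) (a : A) : V -> A :=
  fun y => if y == x then a else s y.

Fixpoint eval (M : structure S) (s : V -> M) (t : term S V) : M :=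
  match t with
  | Var x => s x
  | App f a => interp_func (fun i : 'I_(far f) => eval s (a i))
  end.

Fixpoint sat (M : structure S) (s : V -> M) (phi : formula S V) : Prop :=
  match phi with
  | Bot => False
  | Eq t u => eval s t = eval s u
  | Pred p a => interp_pred (fun i : 'I_(par p) => eval s (a i))
  | Not phi => ~ sat s phi
  | And phi psi => sat s phi /\ sat s psi
  | Ex x phi => exists a : M, sat (update s x a) phi
  end.

Definition models (M : structure S) (T : set (formula S V)) : Prop :=
  forall phi, T phi -> forall s : V -> M, sat s phi.

Definition entails (T : set (formula S V)) (phi : formula S V) : Prop :=
  forall M : structure S, models M T -> forall s : V -> M, sat s phi.

Definition satisfiable (T : set (formula S V)) : Prop :=
  exists M : structure S, models M T.

Definition theory (T : set (formula S V)) : Prop := T `<=` @sentence S V.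

Definition complete_theory (T : set (formula S V)) : Prop :=
  [/\ theory T, satisfiable T
    & forall phi, sentence phi -> entails T phi \/ entails T (Not phi)].

Definition equiv_mod (T : set (formula S V)) (phi psi : formula S V) : Prop :=
  forall M : structure S, models M T -> forall s : V -> M,
    sat s phi <-> sat s psi.

Definition omits (M : structure S) (X : set (formula S V)) : Prop :=
  ~ exists s : V -> M, forall phi, X phi -> sat s phi.

End Semantics.

(* The formulas phi, psi range over full first-order logic, whatever the
   variables V of the theory T are. *)
Definition quantifier_elimination (S : signature) (V : eqType)
    (T : set (formula S V)) : Prop :=
  forall phi : formula S nat, exists psi : formula S nat,
    [/\ quantifier_free psi, free_vars psi = free_vars phi
      & forall M : structure S, models M T -> forall s : nat -> M,
          sat s phi <-> sat s psi].

Definition countable_signature (S : signature) : Prop :=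
  countable [set: func S] /\ countable [set: pred_sym S].

HB.instance Definition _ (S : signature) (V : Type) :=
  gen_eqMixin (formula S V).
HB.instance Definition _ (S : signature) (V : Type) :=
  gen_choiceMixin (formula S V).

Section Lindenbaum.
Variables (S : signature) (V : eqType) (T : set (formula S V)).

Let equivb : rel (formula S V) := fun phi psi => `[< equiv_mod T phi psi >].

Lemma equivb_refl : reflexive equivb.
Proof. by move=> phi; apply/asboolP. Qed.

Lemma equivb_sym : symmetric equivb.
Proof.
move=> phi psi; apply: asbool_equiv_eq.
by split=> h M MT s; apply: iff_sym; apply: h.
Qed.

Lemma equivb_trans : transitive equivb.
Proof.
move=> psi phi chi /asboolP h1 /asboolP h2; apply/asboolP => M MT s.
exact: iff_trans (h1 M MT s) (h2 M MT s).
Qed.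

Canonical equivb_equiv := EquivRel equivb equivb_refl equivb_sym equivb_trans.

(* The Tarski-Lindenbaum algebra Fm_T *)
Definition Fm : Type := {eq_quot equivb}.

HB.instance Definition _ := Choice.on Fm.

Definition Fm_class (phi : formula S V) : Fm := \pi_({eq_quot equivb}) phi.

Let rp (a : Fm) : formula S V := repr (a : {eq_quot equivb}).

Lemma Fm_classP phi psi : Fm_class phi = Fm_class psi <-> equiv_mod T phi psi.
Proof.
split=> [/eqmodP /asboolP //|h].
by apply/eqmodP; apply/asboolP.
Qed.

Lemma rpK a : Fm_class (rp a) = a. Proof. exact: reprK. Qed.

Lemma sat_rp (M : structure S) (s : V -> M) phi : models M T ->
  sat s (rp (Fm_class phi)) = sat s phi.
Proof.
move=> MT; apply/propext.
exact: ((Fm_classP (rp (Fm_class phi)) phi).1 (rpK _) M MT s).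
Qed.

Lemma Fm_eqP a b :
  (forall M : structure S, models M T -> forall s : V -> M,
     sat s (rp a) <-> sat s (rp b)) ->
  a = b.
Proof. by move=> h; rewrite -(rpK a) -(rpK b); apply/Fm_classP. Qed.

Definition Fm_meet (a b : Fm) : Fm := Fm_class (And (rp a) (rp b)).
Definition Fm_join (a b : Fm) : Fm := Fm_class (Or (rp a) (rp b)).
Definition Fm_compl (a : Fm) : Fm := Fm_class (Not (rp a)).
Definition Fm_bot : Fm := Fm_class Bot.
Definition Fm_top : Fm := Fm_class Top.
Definition Fm_le (a b : Fm) : bool := Fm_meet a b == a.
Definition Fm_lt (a b : Fm) : bool := (b != a) && Fm_le a b.

Ltac Fm_tauto :=
  apply: Fm_eqP => ? ? ?;
  rewrite /Fm_meet /Fm_join /Fm_compl /Fm_bot /Fm_top;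
  do ? (rewrite sat_rp //=);
  repeat match goal with
  | |- context [sat ?s (rp ?a)] =>
      case: (pselect (sat s (rp a))); move: (sat s (rp a)) => ?
  end;
  tauto.

Lemma Fm_meetC : commutative Fm_meet. Proof. by move=> a b; Fm_tauto. Qed.
Lemma Fm_joinC : commutative Fm_join. Proof. by move=> a b; Fm_tauto. Qed.
Lemma Fm_meetA : associative Fm_meet. Proof. by move=> a b c; Fm_tauto. Qed.
Lemma Fm_joinA : associative Fm_join. Proof. by move=> a b c; Fm_tauto. Qed.
Lemma Fm_joinKI b a : Fm_meet a (Fm_join a b) = a. Proof. by Fm_tauto. Qed.
Lemma Fm_meetKU b a : Fm_join a (Fm_meet a b) = a. Proof. by Fm_tauto. Qed.
Lemma Fm_meetUl : left_distributive Fm_meet Fm_join.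
Proof. by move=> a b c; Fm_tauto. Qed.
Lemma Fm_meetxx : idempotent_op Fm_meet. Proof. by move=> a; Fm_tauto. Qed.
Lemma Fm_le0x a : Fm_le Fm_bot a. Proof. by apply/eqP; Fm_tauto. Qed.
Lemma Fm_lex1 a : Fm_le a Fm_top. Proof. by apply/eqP; Fm_tauto. Qed.
Lemma Fm_joinxC a : Fm_join a (Fm_compl a) = Fm_top. Proof. by Fm_tauto. Qed.
Lemma Fm_meetxC a : Fm_meet a (Fm_compl a) = Fm_bot. Proof. by Fm_tauto. Qed.

Fact Fm_display : Order.disp_t. Proof. exact: Order.Disp tt tt. Qed.

HB.instance Definition _ := Order.isMeetJoinDistrLattice.Build Fm_display Fm
  (fun _ _ => erefl) (fun _ _ => erefl)
  Fm_meetC Fm_joinC Fm_meetA Fm_joinA Fm_joinKI Fm_meetKU Fm_meetUl Fm_meetxx.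
HB.instance Definition _ := Order.hasBottom.Build Fm_display Fm Fm_le0x.
HB.instance Definition _ := Order.hasTop.Build Fm_display Fm Fm_lex1.
HB.instance Definition _ := Order.TBDistrLattice_hasComplement.Build
  Fm_display Fm Fm_joinxC Fm_meetxC.

(* The order of Fm_T is entailment modulo T. *)
Lemma Fm_class_leP phi psi :
  (Fm_class phi <= Fm_class psi)%O <->
  (forall M : structure S, models M T -> forall s : V -> M,
     sat s phi -> sat s psi).
Proof.
split=> [/eqP/(congr1 rp) h M MT s|h].
  by move/(congr1 (sat s)): h; rewrite !sat_rp //= !sat_rp // => <- [].
apply/eqP; apply: Fm_eqP => M MT s.
rewrite !sat_rp //= !sat_rp //; split=> [[]//|sphi].
by split=> //; apply: h sphi.
Qed.

End Lindenbaum.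

Section Ultrafilter.
Local Open Scope order_scope.

Definition ultrafilter d (B : ctbDistrLatticeType d) (U : set B) : Prop :=
  [/\ U \top /\ ~ U \bot,
      forall a b, U a -> U b -> U (a `&` b),
      forall a b, U a -> a <= b -> U b
    & forall a, U a \/ U (~` a)].

End Ultrafilter.

Section Types.
Variables (S : signature) (V : eqType) (T X : set (formula S V)).

(* The subset of Fm_T corresponding to the type X *)
Definition Fm_set : set (Fm T) := [set Fm_class T phi | phi in X].

Definition complete_type : Prop := ultrafilter Fm_set.

Definition nonprincipal_type : Prop := infimums Fm_set (\bot : Fm T)%O.

End Types.

(* |I| < 2^omega *)
Definition below_continuum (I : Type) : bool :=
  ([set: I] #<= [set: set nat]) && ~~ ([set: set nat] #<= [set: I]).

(* Main.v *)
Require Import Defs.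
From mathcomp Require Import all_boot all_order.
From mathcomp Require Import generic_quotient.
From mathcomp Require Import boolp classical_sets functions cardinality.

(** This is Shelah's argument that fewer than continuum many complete
    non-principal types can be omitted. It builds countable models [N f] of [T],
    one for each [f : nat -> bool], such that every complete type of [T]
    realised in two of them is principal. Then each [X i] is realised in at
    most one [N f]; if every [N f] realised some [X i], choosing such an [i] for
    each [f] would inject the continuum into the index set, so some [N f] omits
    the whole family.

    Fix a model [M0] of [T]. A condition is a formula in the variables
    [x_0, x_1, ...] satisfiable in [M0]. A decreasing sequence of conditions
    that meets all Henkin requirements generates a filter of sets of
    assignments in [M0] from which a model can be read off, whose elements are
    the variables; truth in it is membership in the filter
    ([henkin_model_exists]). Consistency always means satisfiability in [M0],
    so neither a proof system nor compactness enters, and [M0] being a model of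
    [T] makes the new structure one. The conditions are arranged in a binary
    tree ([fusion]), each branch giving one model. At each level finitely many
    requirements are met, by two density arguments: a Henkin requirement can
    always be met by using a fresh variable ([witnesses_dense]); and given two
    nodes and a tuple of variables at each, either the condition at the first
    node isolates the type of its tuple, or both conditions can be strengthened
    so that the two tuples disagree on some formula ([separates_dense]).

    A complete type realised in [N f] and [N g] with [f] and [g] distinct leaves
    the realising tuples no formula of L_n to disagree on, so some condition
    [chi] on the branch [f] decides every such formula about its tuple. Then the
    type is principal ([isolated_realization_principal]): the projection of [chi] to
    this tuple is definable in full first-order logic, hence, by quantifier
    elimination, in L_n ([projection_definable]). Here lies the role of
    quantifier elimination, since a type complete for L_n need not be complete
    for first-order logic. It also makes substitution of variables harmless: it
    is only carried out in quantifier-free formulas, where nothing is captured. *)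

Set Implicit Arguments.
Unset Strict Implicit.
Unset Printing Implicit Defensive.
Local Open Scope quotient_scope.
Local Open Scope classical_set_scope.
Local Open Scope card_scope.

(** * Syntax: renaming, support and countability *)

Section Renaming.
Variables (S : signature) (V W : eqType) (e : V -> W).

Fixpoint rename_term (t : term S V) : term S W :=
  match t with
  | Var x => Var S (e x)
  | App f a => App (fun i => rename_term (a i))
  end.

Fixpoint rename (phi : formula S V) : formula S W :=
  match phi with
  | Bot => Bot
  | Eq t u => Eq (rename_term t) (rename_term u)
  | Pred p a => Pred (fun i => rename_term (a i))
  | Not phi => Not (rename phi)
  | And phi psi => And (rename phi) (rename psi)
  | Ex x phi => Ex (e x) (rename phi)
  end.

Lemma eval_rename (M : structure S) (w : W -> M) t :
  eval w (rename_term t) = eval (w \o e) t.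
Proof.
elim: t => [x|f a IH] //=; congr interp_func.
by apply/funext => i; apply: IH.
Qed.

Lemma eval_args_rename (M : structure S) (w : W -> M) k (a : 'I_k -> term S V) :
  (fun i => eval w (rename_term (a i))) = (fun i => eval (w \o e) (a i)).
Proof. by apply/funext => i; apply: eval_rename. Qed.

Lemma quantifier_free_rename phi :
  quantifier_free (rename phi) = quantifier_free phi.
Proof. by elim: phi => //= phi1 -> phi2 ->. Qed.

(** With a non-injective [e], renaming captures variables under a quantifier;
    hence the two separate substitution lemmas. *)
Lemma sat_rename_qf (M : structure S) (w : W -> M) phi :
  quantifier_free phi -> sat w (rename phi) <-> sat (w \o e) phi.
Proof.
elim: phi => [|t u|p a|phi IH|phi IH1 psi IH2|x phi IH] //=.
- by rewrite !eval_rename.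
- by rewrite eval_args_rename.
- by move/IH->.
- by case/andP => /IH1-> /IH2->.
Qed.

Lemma sat_rename_inj (M : structure S) (w : W -> M) phi :
  injective e -> sat w (rename phi) <-> sat (w \o e) phi.
Proof.
move=> einj; elim: phi w => [|t u|p a|phi IH|phi IH1 psi IH2|x phi IH] w //=.
- by rewrite !eval_rename.
- by rewrite eval_args_rename.
- by rewrite IH.
- by rewrite IH1 IH2.
- suff upd b : update w (e x) b \o e = update (w \o e) x b.
    by split=> -[b]; [rewrite IH upd|rewrite -upd -IH] => hb; exists b.
  by apply/funext => y; rewrite /update /= (inj_eq einj).
Qed.

End Renaming.

Section Support.
Variable S : signature.

Fixpoint term_bound (t : term S nat) : nat :=
  match t with
  | Var x => x.+1
  | App f a => \max_i term_bound (a i)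
  end.

(** Bound variables are counted as well, so this only overestimates the
    support: any variable from [bound phi] on is fresh for [phi]. *)
Fixpoint bound (phi : formula S nat) : nat :=
  match phi with
  | Bot => 0
  | Eq t u => maxn (term_bound t) (term_bound u)
  | Pred p a => \max_i term_bound (a i)
  | Not phi => bound phi
  | And phi psi => maxn (bound phi) (bound psi)
  | Ex x phi => bound phi
  end.

Variable M : structure S.

Lemma eval_agree t (w w' : nat -> M) :
  (forall j, j < term_bound t -> w j = w' j) -> eval w t = eval w' t.
Proof.
elim: t => [x|f a IH] /= h; first exact: h.
congr interp_func; apply/funext => i; apply: IH => j hj.
by apply: h; apply: leq_trans hj _; apply: (leq_bigmax i).
Qed.

Lemma eval_args_agree k (a : 'I_k -> term S nat) (w w' : nat -> M) :
  (forall j, j < \max_i term_bound (a i) -> w j = w' j) ->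
  (fun i => eval w (a i)) = (fun i => eval w' (a i)).
Proof.
move=> h; apply/funext => i; apply: eval_agree => j hj.
by apply: h; apply: leq_trans hj _; apply: (leq_bigmax i).
Qed.

Lemma sat_agree phi (w w' : nat -> M) :
  (forall j, j < bound phi -> w j = w' j) -> sat w phi <-> sat w' phi.
Proof.
elim: phi w w' => [|t u|p a|phi IH|phi IH1 psi IH2|x phi IH] w w' /= h //.
- by rewrite !(@eval_agree _ w w') // => j hj; apply: h; rewrite leq_max hj ?orbT.
- by rewrite (eval_args_agree h).
- by rewrite (IH w w').
- by rewrite (IH1 w w') ?(IH2 w w') // => j hj; apply: h;
     rewrite leq_max hj ?orbT.
- suff upd b : sat (update w x b) phi <-> sat (update w' x b) phi.
    by split=> -[b /upd hb]; exists b.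
  by apply: IH => j hj; rewrite /update; case: eqP => // _; apply: h.
Qed.

End Support.

Definition exs (S : signature) (V : Type) (xs : seq V) (phi : formula S V) :=
  foldr (@Ex S V) phi xs.

Lemma sat_exs (S : signature) (V : eqType) (M : structure S) (xs : seq V)
    (phi : formula S V) (w : V -> M) :
  sat w (exs xs phi) <->
  exists w' : V -> M, (forall x, x \notin xs -> w' x = w x) /\ sat w' phi.
Proof.
elim: xs w => [|x xs IH] w /=.
  split=> [h|[w' [ww' h]]]; first by exists w.
  by rewrite (_ : w = w') //; apply/funext => x; rewrite ww'.
split=> [[a /IH[w' [ww' h]]]|[w' [ww' h]]].
  exists w'; split=> // y; rewrite inE negb_or => /andP[yx yxs].
  by rewrite ww' // /update (negbTE yx).
exists (w' x); apply/IH; exists w'; split=> // y yxs.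
by rewrite /update; case: (eqVneq y x) => [->//|yx]; rewrite ww' // inE negb_or yx.
Qed.

(** Completeness of a theory speaks of sentences only; this closure makes it
    applicable to an arbitrary formula of L_n without leaving L_n. *)
Lemma sentence_exs_enum (S : signature) n (phi : formula S 'I_n) :
  sentence (exs (enum 'I_n) phi).
Proof.
rewrite /sentence -subset0 => x.
have sub (xs : seq 'I_n) y : free_vars (exs xs phi) y -> y \notin xs.
  elim: xs => [|z xs IH] //= [/IH yxs] yz.
  by rewrite inE negb_or yxs andbT; apply/eqP.
by move=> /sub; rewrite mem_enum.
Qed.

Section Countability.
Variable S : signature.
Hypothesis hS : countable_signature S.

Let injection_to_nat (A : Type) : countable [set: A] ->
  exists c : A -> nat, injective c.
Proof. by move=> /countable_injP[c ci]; exists c => x y; apply: ci; rewrite inE. Qed.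

Lemma formula_injection : exists c : formula S nat -> GenTree.tree nat, injective c.
Proof.
have [/injection_to_nat[cf cf_inj] /injection_to_nat[cp cp_inj]] := hS.
pose ct := fix ct (t : term S nat) : GenTree.tree nat := match t with
  | Var x => GenTree.Leaf x
  | App f a => GenTree.Node (cf f) [seq ct (a i) | i <- enum 'I_(far f)]
  end.
pose c := fix c (phi : formula S nat) : GenTree.tree nat := match phi with
  | Bot => GenTree.Node 0 [::]
  | Eq t u => GenTree.Node 1 [:: ct t; ct u]
  | Pred p a =>
      GenTree.Node 2 (GenTree.Leaf (cp p) :: [seq ct (a i) | i <- enum 'I_(par p)])
  | Not phi => GenTree.Node 3 [:: c phi]
  | And phi psi => GenTree.Node 4 [:: c phi; c psi]
  | Ex x phi => GenTree.Node 5 [:: GenTree.Leaf x; c phi]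
  end.
have ct_inj : injective ct.
  elim=> [x|f a IH] [y|g b] //= => [[->]//|[/cf_inj fg]].
  case: _ / fg b => b /eq_in_map ab; congr App; apply/funext => i.
  by apply: IH; apply: ab; rewrite mem_enum.
exists c; elim=> [|t u|p a|phi IH|phi IH1 psi IH2|x phi IH]
  [|t' u'|q b|phi'|phi' psi'|x' phi'] //=.
- by case=> /ct_inj-> /ct_inj->.
- case=> /cp_inj pq; case: _ / pq b => b /eq_in_map ab; congr Pred.
  by apply/funext => i; apply: ct_inj; apply: ab; rewrite mem_enum.
- by case=> /IH->.
- by case=> /IH1-> /IH2->.
- by case=> -> /IH->.
Qed.

End Countability.

(** * Models named by the variables *)

Definition structure_qe (S : signature) (V : eqType) (M : structure S) :=
  forall phi : formula S V, exists psi : formula S V,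
    quantifier_free psi /\ forall s : V -> M, sat s phi <-> sat s psi.

Section HenkinModel.
Variables (S : signature) (M0 : structure S) (H : set (set (nat -> M0))).

(** [H] consists of the properties forced on the values in [M0] of the variables
    [x_0, x_1, ...]. The last clause asks that either
    no value of [x] satisfies [theta], or some variable names such a value;
    applied with a variable [x] fresh for [theta] it also decides [theta]. *)
Definition henkin_filter : Prop :=
  [/\ H [set: nat -> M0],
      forall P Q, P `<=` Q -> H P -> H Q,
      forall P Q, H P -> H Q -> H (P `&` Q),
      ~ H set0
    & forall (theta : formula S nat) x, quantifier_free theta ->
        H [set w | ~ exists a, sat (update w x a) theta] \/
        exists y, H [set w | sat (update w x (w y)) theta]].

Hypothesis hH : henkin_filter.

Lemma filter_sub P Q : P `<=` Q -> H P -> H Q.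
Proof. by case: hH => _ + _ _ _; apply. Qed.

Lemma filter_setI P Q : H P -> H Q -> H (P `&` Q).
Proof. by case: hH => _ _ + _ _; apply. Qed.

Lemma filter_disjoint P Q : P `&` Q `<=` set0 -> H P -> ~ H Q.
Proof.
move=> PQ hP hQ; case: hH => _ _ _ + _; apply.
exact: filter_sub PQ (filter_setI hP hQ).
Qed.

Lemma filter_forall k (P : 'I_k -> set (nat -> M0)) :
  (forall i, H (P i)) -> H [set w | forall i, P i w].
Proof.
move=> hP.
have hs (s : seq 'I_k) : H [set w | forall i, i \in s -> P i w].
  elim: s => [|i s IH]; first by case: hH => hT *; apply: filter_sub hT.
  apply: filter_sub (filter_setI (hP i) IH) => w [hi hs] j.
  by rewrite inE => /orP[/eqP->|/hs].
by apply: filter_sub (hs (enum 'I_k)) => w h i; apply: h; rewrite mem_enum.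
Qed.

Lemma filter_decides (theta : formula S nat) : quantifier_free theta ->
  H [set w | sat w theta] \/ H [set w | ~ sat w theta].
Proof.
move=> qf; case: hH => _ _ _ _ /(_ theta (bound theta) qf).
have fresh (w : nat -> M0) a : sat (update w (bound theta) a) theta <-> sat w theta.
  by apply: sat_agree => j; rewrite /update; case: eqP => [->|//]; rewrite ltnn.
case=> [h|[y h]]; [right|left]; apply: filter_sub h => w /=.
  by move=> hn hw; apply: hn; exists (w 0); apply/fresh.
by move/fresh.
Qed.

(** The Henkin clause for the formula [t = x] with [x] fresh: it has a solution
    under every assignment, so its first alternative is excluded. *)
Lemma filter_names_term (t : term S nat) : exists y, H [set w | eval w t = w y].
Proof.
pose x := term_bound t.
have fresh (w : nat -> M0) a : eval (update w x a) t = eval w t.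
  by apply: eval_agree => j; rewrite /update; case: eqP => [->|//]; rewrite ltnn.
case: hH => _ _ _ _ /(_ (Eq t (Var S x)) x erefl) [h|[y h]]; last first.
  exists y; apply: filter_sub h => w /=.
  by rewrite fresh /update eqxx.
exfalso; case: hH => _ _ _ + _; apply; apply: filter_sub h => w /=; apply.
by exists (eval w t); rewrite fresh /update eqxx.
Qed.

Let same_element : rel nat := fun x y => `[< H [set w | w x = w y] >].

Let same_element_equiv : equiv_class_of same_element.
Proof.
split=> [x|x y|y x z].
- by apply/asboolP; case: hH => hT *; apply: filter_sub hT.
- by apply/asboolP/asboolP; apply: filter_sub => w /=.
- move=> /asboolP h1 /asboolP h2; apply/asboolP.
  by apply: filter_sub (filter_setI h1 h2) => w /= [-> ->].
Qed.

Let same_element_rel := EquivRelPack same_element_equiv.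
Let elt : Type := {eq_quot same_element_rel}.
Let cls (x : nat) : elt := \pi_({eq_quot same_element_rel}) x.
Let name (b : elt) : nat := repr (b : {eq_quot same_element_rel}).

Let clsE x y : cls x = cls y <-> H [set w | w x = w y].
Proof. by split=> [/eqmodP/asboolP|h] //; apply/eqmodP/asboolP. Qed.

Let nameK b : cls (name b) = b.
Proof. exact: reprK. Qed.

Let value_name (f : func S) (b : 'I_(far f) -> elt) : nat :=
  xget 0 [set y | H [set w : nat -> M0 | interp_func (w \o name \o b) = w y]].

(** Elements are variables, identified when [H] forces their values to agree;
    equivalently, this is the substructure of the reduced power of [M0] by [H]
    that consists of the classes of the coordinate maps [w |-> w x]. *)
Let henkin_model : structure S :=
  @Structure S elt (inhabits (cls 0))
    (fun f b => cls (value_name b))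
    (fun p b => H [set w : nat -> M0 | interp_pred (w \o name \o b)]).

Lemma value_nameP (f : func S) (b : 'I_(far f) -> elt) :
  H [set w : nat -> M0 | interp_func (w \o name \o b) = w (value_name b)].
Proof.
have [y hy] := filter_names_term (App (fun i => Var S (name (b i)))).
pose named := [set y | H [set w : nat -> M0 | interp_func (w \o name \o b) = w y]].
by apply: (@xgetPex _ 0 named); exists y.
Qed.

Lemma henkin_eval (V : eqType) (t : term S V) (r : V -> nat) :
  H [set w : nat -> M0 | eval (w \o r) t = w (name (@eval S V henkin_model (cls \o r) t))].
Proof.
elim: t => [x|f a IH] /=; first by apply/clsE; rewrite nameK.
set b : 'I_(far f) -> elt := fun i => _.
have hb : H [set w : nat -> M0 | w (value_name b) = w (name (cls (value_name b)))].
  by apply/clsE; rewrite nameK.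
apply: filter_sub (filter_setI (filter_forall IH) (filter_setI (value_nameP b) hb)).
move=> w [/= ha [/= hv <-]]; rewrite -hv; congr interp_func.
by apply/funext => i; apply: ha.
Qed.

(** The truth lemma. Quantifiers need a variable outside the finite range of
    [r]; substituting it for the bound one in [phi] is safe because [phi] may
    be replaced by a quantifier-free equivalent, which the hypothesis on [M0]
    supplies. *)
Lemma henkin_sat (V : finType)
    (qe : structure_qe V M0)
    (phi : formula S V) (r : V -> nat) :
  @sat S V henkin_model (cls \o r) phi <-> H [set w : nat -> M0 | sat (w \o r) phi].
Proof.
have dec (psi : formula S V) (q : V -> nat) :
    H [set w : nat -> M0 | sat (w \o q) psi] \/ H [set w : nat -> M0 | ~ sat (w \o q) psi].
  have [psi' [qf psi'E]] := qe psi.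
  have := qf; rewrite -(quantifier_free_rename q) => /filter_decides.
  case=> h; [left|right]; apply: filter_sub h => w /=;
  by rewrite sat_rename_qf // -psi'E.
have neg (psi : formula S V) (q : V -> nat) :
    H [set w : nat -> M0 | ~ sat (w \o q) psi] <-> ~ H [set w : nat -> M0 | sat (w \o q) psi].
  split; last by case: (dec psi q).
  by apply: filter_disjoint => w [].
elim: phi r => [|t u|p a|phi IH|phi IH1 psi IH2|x phi IH] r /=.
- by split=> // h; case: hH => _ _ _ + _; apply; apply: filter_sub h.
- have [ht hu] := (henkin_eval t r, henkin_eval u r).
  split=> [tu|h].
    rewrite -tu in hu.
    by apply: filter_sub (filter_setI ht hu) => w /= [-> ->].
  rewrite -[LHS]nameK -[RHS]nameK; apply/clsE.
  apply: filter_sub (filter_setI h (filter_setI ht hu)) => w /= [+ [<- <-]] //.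
- have ha := filter_forall (fun i => henkin_eval (a i) r).
  split=> h; apply: filter_sub (filter_setI h ha) => w [/= hw haw].
    by rewrite (funext haw : (fun i => _) = _).
  by rewrite (funext haw : (fun i => _) = _) in hw.
- by rewrite neg IH.
- rewrite IH1 IH2; split=> [[]|h]; first exact: filter_setI.
  by split; apply: filter_sub h => w [].
- have upd y : update (cls \o r) x (cls y) = cls \o update r x y.
    by apply/funext => z; rewrite /update /=; case: eqP.
  have updw (w : nat -> M0) y : update (w \o r) x (w y) = w \o update r x y.
    by apply/funext => z; rewrite /update /=; case: eqP.
  split=> [[b]|h].
    rewrite -(nameK b) upd IH; apply: filter_sub => w /=.
    by rewrite -updw => hw; exists (w (name b)).
  have [psi [qf psiE]] := qe phi.
  (* [z] plays the bound variable and lies outside the range of [r]. *)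
  pose z := (\max_v r v).+1.
  have rz (w : nat -> M0) a : update w z a \o update r x z = update (w \o r) x a.
    apply/funext => v; rewrite /update /=; case: (v == x); first by rewrite eqxx.
    by rewrite ltn_eqF // ltnS; apply: leq_bigmax.
  have qf' : quantifier_free (rename (update r x z) psi).
    by rewrite quantifier_free_rename.
  have thetaE (w : nat -> M0) a :
      sat (update w z a) (rename (update r x z) psi) <->
      sat (update (w \o r) x a) phi.
    by rewrite sat_rename_qf // rz psiE.
  case: hH => _ _ _ _ /(_ _ z qf') [hn|[y hy]].
    case: (@filter_disjoint _ _ _ h hn) => w [/= [a ha]]; apply.
    by exists a; apply/thetaE.
  exists (cls y); rewrite upd IH; apply: filter_sub hy => w /=.
  by move/thetaE; rewrite updw.
Qed.

Theorem henkin_model_exists (V : finType) :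
  structure_qe V M0 ->
  exists (N : structure S) (el : nat -> N), (forall b, exists x, el x = b) /\
    forall (phi : formula S V) (r : V -> nat),
      sat (el \o r) phi <-> H [set w : nat -> M0 | sat (w \o r) phi].
Proof.
move=> qe; exists henkin_model, cls; split=> [b|phi r]; last exact: henkin_sat.
by exists (name b); apply: nameK.
Qed.

End HenkinModel.

(** * Quantifier elimination brought down to n variables *)

Section FiniteVariableQE.
Variables (n : nat) (n_gt0 : 0 < n) (S : signature) (T : set (formula S 'I_n)).
Hypothesis hQE : quantifier_elimination T.

Let clip (j : nat) : 'I_n := insubd (Ordinal n_gt0) j.

Let clipK (A : Type) (s : 'I_n -> A) : s \o clip \o val = s.
Proof. by apply/funext => i; rewrite /= /clip valKd. Qed.

(** A quantifier-free formula in infinitely many variables can be read in L_n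
    by renaming: all variables from [n] on are merged into one of the first
    [n], which changes nothing if the formula does not depend on them. *)
Lemma definable_by_qf_Ln (phi : formula S nat) :
  exists psi : formula S 'I_n, quantifier_free psi /\
    forall M : structure S, models M T -> forall s : 'I_n -> M,
      sat s psi <-> sat (s \o clip) phi.
Proof.
have [psi [qf _ psiE]] := hQE phi.
exists (rename clip psi); split; first by rewrite quantifier_free_rename.
by move=> M MT s; rewrite sat_rename_qf // -psiE.
Qed.

Lemma qe_Ln (M : structure S) : models M T -> structure_qe 'I_n M.
Proof.
move=> MT phi; have [psi [qf psiE]] := definable_by_qf_Ln (rename val phi).
exists psi; split=> // s.
by rewrite psiE // sat_rename_inj ?clipK //; apply: val_inj.
Qed.

(** The types of the [n]-tuple of variables [u] compatible with [chi] are cut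
    out by a single formula of L_n, although saying this needs quantifiers over
    all the variables of [chi]. This is where elimination for full first-order
    logic, and not only for L_n, is used. *)
Lemma projection_definable (chi : formula S nat) (u : 'I_n -> nat) :
  exists eps : formula S 'I_n,
    forall M : structure S, models M T -> forall s : 'I_n -> M,
      sat s eps <-> exists w : nat -> M, sat w chi /\ w \o u = s.
Proof.
(* [x_i] for [i < n] stands for the tuple, [x_(n + j)] for the variable [x_j]
   of [chi]; [m] bounds all the [j] that matter, so that the block of variables
   from [n] to [n + m - 1] can be quantified away. *)
pose m := maxn (bound chi) (\max_i u i).+1.
have um i : u i < m by rewrite leq_max ltnS leq_bigmax ?orbT.
pose eqs := foldr (fun i => And (Eq (Var S (val i)) (Var S (n + u i))))
  Top (enum 'I_n).
have eqsE (M : structure S) (v : nat -> M) :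
    sat v eqs <-> forall i : 'I_n, v i = v (n + u i).
  have : sat v eqs <-> forall i : 'I_n, i \in enum 'I_n -> v i = v (n + u i).
    rewrite /eqs; elim: (enum 'I_n) => [|i s IH] /=; first by split=> [_ i|_ []].
    rewrite IH; split=> [[hi hs] j|h].
      by rewrite inE => /orP[/eqP->|/hs].
    split; first by apply: h; rewrite mem_head.
    by move=> j js; apply: h; rewrite inE js orbT.
  move->; split=> h i; last by move=> _.
  by apply: h; rewrite mem_enum.
pose theta := exs (iota n m) (And (rename (addn n) chi) eqs).
have [eps [_ epsE]] := definable_by_qf_Ln theta.
exists eps => M MT s; rewrite epsE // sat_exs /=.
split=> [[v [vs []]]|[w [hw ws]]].
  rewrite sat_rename_inj; last exact: addnI.
  move=> hv /eqsE hs; exists (v \o addn n); split=> //.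
  apply/funext => i /=; rewrite -hs vs ?mem_iota 1?leqNgt ?ltn_ord //=.
  exact: (congr1 (fun s => s i) (clipK s)).
pose v j := if n <= j < n + m then w (j - n) else s (clip j).
exists v; split; first by move=> j; rewrite mem_iota /v => /negbTE ->.
have vn j : j < m -> v (n + j) = w j.
  by move=> jm; rewrite /v leq_addr ltn_add2l jm addKn.
split.
  rewrite sat_rename_inj; last exact: addnI.
  rewrite (@sat_agree _ _ chi _ w) // => j hj.
  by rewrite /= vn //; apply: leq_trans hj _; rewrite leq_maxl.
apply/eqsE => i; rewrite vn // /v leqNgt ltn_ord /=.
by rewrite -[in RHS]/((w \o u) i) ws; exact: (congr1 (fun s => s i) (clipK s)).
Qed.

End FiniteVariableQE.

(** * Forcing conditions and the two density arguments *)

Section Conditions.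
Variables (n : nat) (S : signature) (M0 : structure S).

Definition sols (chi : formula S nat) : set (nat -> M0) := [set w | sat w chi].

Definition consistent (chi : formula S nat) := exists w, sols chi w.

(** Any filter containing [sols chi] for such a [chi] satisfies the last clause
    of [henkin_filter] for [theta] and [x]. *)
Definition witnesses (theta : formula S nat) (x : nat) (chi : formula S nat) :=
  sols chi `<=` [set w | ~ exists a, sat (update w x a) theta] \/
  exists y, sols chi `<=` [set w | sat (update w x (w y)) theta].

Definition isolates (u : 'I_n -> nat) (chi : formula S nat) :=
  forall phi : formula S 'I_n,
    sols chi `<=` [set w : nat -> M0 | sat (w \o u) phi] \/
    sols chi `<=` [set w : nat -> M0 | ~ sat (w \o u) phi].

Definition separates (u v : 'I_n -> nat) (chi chi' : formula S nat) :=
  exists phi : formula S 'I_n,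
    sols chi `<=` [set w : nat -> M0 | sat (w \o u) phi] /\
    sols chi' `<=` [set w : nat -> M0 | ~ sat (w \o v) phi].

Lemma witnesses_sub theta x chi chi' : sols chi' `<=` sols chi ->
  witnesses theta x chi -> witnesses theta x chi'.
Proof.
move=> sub [h|[y h]]; [left|right; exists y]; exact: subset_trans sub h.
Qed.

Lemma isolates_sub u chi chi' : sols chi' `<=` sols chi ->
  isolates u chi -> isolates u chi'.
Proof.
by move=> sub h phi; case: (h phi) => {}h; [left|right]; apply: subset_trans sub h.
Qed.

Lemma separates_sub u v chi1 chi1' chi2 chi2' :
  sols chi1' `<=` sols chi1 -> sols chi2' `<=` sols chi2 ->
  separates u v chi1 chi2 -> separates u v chi1' chi2'.
Proof.
move=> sub1 sub2 [phi [h1 h2]]; exists phi.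
by split; [apply: subset_trans sub1 h1|apply: subset_trans sub2 h2].
Qed.

(** If some assignment compatible with [chi] extends to a solution of [theta],
    give that solution a name [y] on which neither formula depends. *)
Lemma witnesses_dense theta x chi : quantifier_free theta -> consistent chi ->
  exists chi', [/\ sols chi' `<=` sols chi, consistent chi' & witnesses theta x chi'].
Proof.
move=> qf [w hw].
have [[w0 [hw0 [a ha]]]|none] :=
    pselect (exists w0, sols chi w0 /\ exists a, sat (update w0 x a) theta); last first.
  exists chi; split=> //; first by exists w.
  by left=> w0 hw0 ha; apply: none; exists w0.
pose y := maxn x.+1 (maxn (bound chi) (bound theta)).
pose e := update id x y.
have eE (w1 : nat -> M0) : w1 \o e = update w1 x (w1 y).
  by apply/funext => j; rewrite /e /update /=; case: eqP.
exists (And chi (rename e theta)); split.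
- by move=> w1 [].
- exists (update w0 y a); split=> /=.
    rewrite (@sat_agree _ _ chi _ w0) // => j hj; rewrite /update ltn_eqF //.
    by rewrite /y !leq_max hj orbT.
  rewrite sat_rename_qf // eE (@sat_agree _ _ theta _ (update w0 x a)) // => j hj.
  rewrite /update eqxx; case: (j == x) => //; rewrite ltn_eqF //.
  by rewrite /y !leq_max hj !orbT.
- by right; exists y => w1; rewrite /sols /= => -[_]; rewrite sat_rename_qf // eE.
Qed.

(** If [chi1] does not isolate the type of [u], some [phi] is left open on [u];
    whichever way [phi] can hold of [v] under [chi2], decide it that way on [v]
    and the opposite way on [u]. *)
Lemma separates_dense (u v : 'I_n -> nat) chi1 chi2 :
  structure_qe 'I_n M0 ->
  consistent chi1 -> consistent chi2 ->
  exists chi1' chi2', [/\ sols chi1' `<=` sols chi1, sols chi2' `<=` sols chi2,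
    consistent chi1', consistent chi2'
    & isolates u chi1' \/ separates u v chi1' chi2'].
Proof.
move=> qe c1 c2; have [iso|niso] := pselect (isolates u chi1).
  by exists chi1, chi2; split=> //; left.
have [phi [psi [qf psiE [w1 [hw1 pos]] [w1' [hw1' neg]]]]] :
    exists phi psi : formula S 'I_n, [/\ quantifier_free psi,
      forall s : 'I_n -> M0, sat s phi <-> sat s psi,
      exists w : nat -> M0, sols chi1 w /\ sat (w \o u) phi
      & exists w : nat -> M0, sols chi1 w /\ ~ sat (w \o u) phi].
  apply: contrapT => h; apply: niso => phi; apply: contrapT => hphi.
  apply: h; have [psi [qf psiE]] := qe phi; exists phi, psi.
  split=> //; apply: contrapT => h; apply: hphi; [right|left] => w hw /=.
    by move=> hphi; apply: h; exists w.
  by apply: contrapT => hphi; apply: h; exists w.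
have [w2 hw2] := c2.
(* As [phi] is applied to variables [t i], it is used in quantifier-free form. *)
have sat_psi (w : nat -> M0) (t : 'I_n -> nat) :
    sat w (rename t psi) <-> sat (w \o t) phi.
  by rewrite sat_rename_qf // -psiE.
have [phi2|phi2] := pselect (sat (w2 \o v) phi).
- exists (And chi1 (Not (rename u psi))), (And chi2 (rename v psi)).
  split; try by move=> w [].
  + by exists w1'; split=> //=; rewrite sat_psi.
  + by exists w2; split=> //=; rewrite sat_psi.
  + right; exists (Not phi); split=> w; rewrite /sols /= => -[_]; rewrite sat_psi //.
    by move=> h; apply.
- exists (And chi1 (rename u psi)), (And chi2 (Not (rename v psi))).
  split; try by move=> w [].
  + by exists w1; split=> //=; rewrite sat_psi.
  + by exists w2; split=> //=; rewrite sat_psi.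
  + by right; exists phi; split=> w; rewrite /sols /= => -[_]; rewrite sat_psi.
Qed.

End Conditions.

Arguments sols {S} M0 chi _.

(** * A perfect tree of conditions *)

Section Tree.

(** The restriction of [f] to the numbers below [k], latest bit first, so that
    the parent of a node is its tail. *)
Fixpoint branch (f : nat -> bool) (k : nat) : seq bool :=
  if k is k'.+1 then f k' :: branch f k' else [::].

Fixpoint bitstrings (k : nat) : seq (seq bool) :=
  if k is k'.+1 then [seq b :: s | b <- [:: true; false], s <- bitstrings k']
  else [:: [::]].

Lemma branch_bitstrings f k : branch f k \in bitstrings k.
Proof.
elim: k => //= k IH; rewrite cats0 mem_cat.
by case: (f k); rewrite map_f ?orbT.
Qed.

Lemma branch_eq f g k : branch f k = branch g k -> forall j, j < k -> f j = g j.
Proof.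
elim: k => //= k IH [fgk /IH fg] j; rewrite ltnS leq_eqVlt.
by case/orP => [/eqP->|/fg].
Qed.

End Tree.

Section Fusion.
Variables (n : nat) (S : signature) (M0 : structure S).
Hypothesis qe : structure_qe 'I_n M0.

(** A Henkin requirement (formula and variable) bundled with a pair of tuples
    whose types are to be kept apart. *)
Definition task : Type :=
  (formula S nat * nat * ({ffun 'I_n -> nat} * {ffun 'I_n -> nat}))%type.

Definition labelling := seq bool -> formula S nat.

Definition consistent_labelling (c : labelling) :=
  forall sigma, consistent M0 (c sigma).

Definition stronger (c' c : labelling) :=
  forall sigma, sols M0 (c' sigma) `<=` sols M0 (c sigma).

Definition meets (sigma tau : seq bool) (t : task) (c : labelling) :=
  (quantifier_free t.1.1 -> witnesses M0 t.1.1 t.1.2 (c sigma)) /\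
  (sigma <> tau -> isolates M0 t.2.1 (c sigma) \/
     separates M0 t.2.1 t.2.2 (c sigma) (c tau)).

Lemma stronger_refl c : stronger c c.
Proof. by move=> sigma w. Qed.
#[local] Hint Resolve stronger_refl : core.

Lemma stronger_trans c1 c2 c3 : stronger c1 c2 -> stronger c2 c3 -> stronger c1 c3.
Proof. by move=> s12 s23 sigma; apply: subset_trans (s12 _) (s23 _). Qed.

Lemma meets_stronger sigma tau t c c' :
  stronger c' c -> meets sigma tau t c -> meets sigma tau t c'.
Proof.
move=> cc' [hw hs]; split=> [/hw|/hs [h|h]]; first exact: witnesses_sub.
  by left; apply: isolates_sub h.
by right; apply: separates_sub h.
Qed.

Lemma relabel c sigma chi : consistent_labelling c ->
  sols M0 chi `<=` sols M0 (c sigma) -> consistent M0 chi ->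
  consistent_labelling (update c sigma chi) /\ stronger (update c sigma chi) c.
Proof.
move=> ok sub con; split=> rho; rewrite /update; first by case: eqP.
by case: eqP => [->|_].
Qed.

Lemma meets_dense sigma tau t c : consistent_labelling c ->
  exists c', [/\ consistent_labelling c', stronger c' c & meets sigma tau t c'].
Proof.
move: t => [[theta x] [u v]] ok.
have [c1 [ok1 s1 w1]] : exists c1, [/\ consistent_labelling c1, stronger c1 c
    & quantifier_free theta -> witnesses M0 theta x (c1 sigma)].
  have [qf|nqf] := boolP (quantifier_free theta); last first.
    by exists c; split=> // qf; case/negP: nqf.
  have [chi [sub con wit]] := witnesses_dense x qf (ok sigma).
  have [ok1 s1] := relabel ok sub con.
  by exists (update c sigma chi); split=> // _; rewrite /update eqxx.
have [st|st] := eqVneq sigma tau; first by exists c1; split=> //; split=> //= /(_ st).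
have [chi [chi' [sub sub' con con' sep]]] :=
  separates_dense u v qe (ok1 sigma) (ok1 tau).
have [ok2 s2] := relabel ok1 sub con.
have sub2 : sols M0 chi' `<=` sols M0 (update c1 sigma chi tau).
  by rewrite /update eq_sym (negbTE st).
have [ok3 s3] := relabel ok2 sub2 con'.
exists (update (update c1 sigma chi) tau chi'); split=> //.
  exact: stronger_trans s3 (stronger_trans s2 s1).
split=> /= [qf|_].
  exact: witnesses_sub (subset_trans (s3 _) (s2 _)) (w1 qf).
by rewrite /update (negbTE st) !eqxx.
Qed.

Variable task_of : nat -> task.

(** Requirements survive strengthening, so finitely many of them can be met one
    after the other; at each level of the tree there are only finitely many. *)
Lemma meets_all (L : seq (seq bool * seq bool * nat)) c : consistent_labelling c ->
  exists c', [/\ consistent_labelling c', stronger c' c &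
    forall sigma tau j, (sigma, tau, j) \in L -> meets sigma tau (task_of j) c'].
Proof.
elim: L c => [|[[sigma tau] j] L IH] c ok; first by exists c; split.
have [c1 [ok1 s1 m1]] := meets_dense sigma tau (task_of j) ok.
have [c2 [ok2 s2 m2]] := IH c1 ok1.
exists c2; split=> // [|sigma' tau' j']; first exact: stronger_trans s2 s1.
rewrite inE => /orP[/eqP[-> -> ->]|]; last exact: m2.
exact: meets_stronger s2 m1.
Qed.

Definition level_tasks (k : nat) : seq (seq bool * seq bool * nat) :=
  [seq (st, j) | st <- [seq (sigma, tau) | sigma <- bitstrings k, tau <- bitstrings k],
     j <- iota 0 k].

Lemma mem_level_tasks k sigma tau j : sigma \in bitstrings k ->
  tau \in bitstrings k -> j < k -> (sigma, tau, j) \in level_tasks k.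
Proof.
move=> hs ht hj; apply: allpairs_f; last by rewrite mem_iota.
exact: allpairs_f.
Qed.

Hypothesis M0_sat : inhabited M0.

(** Level [k] labels every node, after which each node of length [k] passes its
    label on to both children. The first [k] tasks are treated anew at each
    level [k], because two branches may part only long after a task has first
    come up. *)
Lemma fusion : exists chi : (nat -> bool) -> nat -> formula S nat,
  [/\ forall f k, consistent M0 (chi f k),
      forall f k, sols M0 (chi f k.+1) `<=` sols M0 (chi f k),
      forall f j, quantifier_free (task_of j).1.1 ->
        witnesses M0 (task_of j).1.1 (task_of j).1.2 (chi f j.+1)
    & forall f g j k, j < k -> branch f k <> branch g k ->
        isolates M0 (task_of j).2.1 (chi f k) \/
        separates M0 (task_of j).2.1 (task_of j).2.2 (chi f k) (chi g k)].
Proof.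
have step (kc : nat * {c | consistent_labelling c}) :
    exists c' : {c | consistent_labelling c}, stronger (sval c') (sval kc.2) /\
      forall sigma tau j, (sigma, tau, j) \in level_tasks kc.1 ->
        meets sigma tau (task_of j) (sval c').
  case: kc => k [c ok] /=; have [c' [ok' s' m']] := meets_all (level_tasks k) ok.
  by exists (exist _ c' ok').
have [F FP] := choice step.
have ok0 : consistent_labelling (fun=> Top).
  by case: M0_sat => a sigma; exists (fun=> a); rewrite /sols /=; case.
have oks (c : {c | consistent_labelling c}) :
    consistent_labelling (sval c \o behead) by case: c => c ok sigma; apply: ok.
pose start := fix start k : {c | consistent_labelling c} :=
  if k is k'.+1 then exist _ _ (oks (F (k', start k'))) else exist _ _ ok0.
pose c k := sval (F (k, start k)).
have cm k : forall sigma tau j, (sigma, tau, j) \in level_tasks k ->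
    meets sigma tau (task_of j) (c k) := (FP (k, start k)).2.
exists (fun f k => c k (branch f k)); split=> [f k|f k|f j qf|f g j k jk fg].
- by rewrite /c; case: (F _) => c' ok' /=; apply: ok'.
- exact: ((FP (k.+1, start k.+1)).1 (branch f k.+1)).
- apply: (cm _ _ (branch f j.+1) j _).1 => //.
  by apply: mem_level_tasks => //; apply: branch_bitstrings.
- apply: (cm _ _ _ j _).2 => //.
  by apply: mem_level_tasks => //; apply: branch_bitstrings.
Qed.

End Fusion.

Lemma enumerate_tasks n (S : signature) : countable_signature S ->
  exists task_of : nat -> task n S, forall t, exists j, task_of j = t.
Proof.
move=> hS; have [c c_inj] := formula_injection hS.
pose code (t : task n S) := pickle (c t.1.1, t.1.2, t.2).
have code_inj : injective code.
  move=> [[theta x] uv] [[theta' x'] uv'] /(pcan_inj pickleK) [].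
  by move=> /c_inj-> -> ->.
pose t0 : task n S := (Bot, 0, ([ffun=> 0], [ffun=> 0])).
exists (fun j => xget t0 [set t | code t = j]) => t; exists (code t).
by apply: code_inj; apply: (@xgetPex _ t0 [set t' | code t' = code t]); exists t.
Qed.

(** * Types realised in the constructed models *)

Section IsolatedTypes.
Variables (n : nat) (n_gt0 : 0 < n) (S : signature) (T : set (formula S 'I_n)).
Hypotheses (hT : complete_theory T) (hQE : quantifier_elimination T).
Variables (M0 N : structure S) (M0T : models M0 T).

(** The projection of [chi] to [u] is definable in L_n and not split by any
    formula of L_n in [M0]; completeness of [T] turns this into entailment in
    all models, so the class of that formula is a nonzero lower bound of the
    type. *)
Lemma isolated_realization_principal (u : 'I_n -> nat) chi (s : 'I_n -> N)
    (X : set (formula S 'I_n)) :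
  consistent M0 chi -> isolates M0 u chi ->
  (forall phi : formula S 'I_n,
     sols M0 chi `<=` [set w : nat -> M0 | sat (w \o u) phi] -> sat s phi) ->
  (forall phi, X phi -> sat s phi) ->
  ~ nonprincipal_type T X.
Proof.
move=> [w0 hw0] iso forced real [_ /= inf].
have [eps epsE] := projection_definable n_gt0 hQE chi u.
have eps_lb : lbound (@Fm_set S 'I_n T X) (Fm_class T eps).
  move=> _ [psi Xpsi <-]; apply/Fm_class_leP => M MT t ht.
  have chi_psi : sols M0 chi `<=` [set w : nat -> M0 | sat (w \o u) psi].
    case: (iso psi) => // neg.
    by case: (forced (Not psi) neg); apply: real.
  apply: contrapT => npsi.
  case: hT => _ _ /(_ _ (sentence_exs_enum (And eps (Not psi)))) [] ent.
    have /sat_exs[t' [_ /= [/epsE[//|w [hw <-]]]]] := ent M0 M0T (w0 \o u).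
    by apply; apply: chi_psi.
  apply: (ent M MT t); apply/sat_exs; exists t; split=> //.
have /Fm_class_leP/(_ M0 M0T (w0 \o u)) : (Fm_class T eps <= Fm_class T Bot)%O :=
  inf _ eps_lb.
by apply; apply/epsE => //; exists w0.
Qed.

Lemma complete_type_decides (X : set (formula S 'I_n)) (phi : formula S 'I_n) :
  complete_type T X -> exists psi, X psi /\
    ((forall (M : structure S) (s : 'I_n -> M), models M T -> sat s psi -> sat s phi) \/
     (forall (M : structure S) (s : 'I_n -> M), models M T -> sat s psi -> ~ sat s phi)).
Proof.
case=> _ _ _ /(_ (Fm_class T phi)) [] [psi Xpsi psiE]; exists psi; split=> //.
  by left=> M s MT; move/Fm_classP: psiE => /(_ M MT s)[].
right=> M s MT hpsi.
by move/Fm_classP: psiE => /(_ M MT s)[/(_ hpsi)] /= + _; rewrite sat_rp.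
Qed.

End IsolatedTypes.

Theorem corollary6p4 (n : nat) (hn : (2 < n)%N) (S : signature)
    (hS : countable_signature S)
    (T : set (formula S 'I_n))
    (hT : complete_theory T)
    (hQE : quantifier_elimination T)
    (I : Type) (hI : below_continuum I)
    (X : I -> set (formula S 'I_n))
    (hX : forall i : I, complete_type T (X i) /\ nonprincipal_type T (X i)) :
  exists M : structure S,
    [/\ countable [set: M]%classic, models M T & forall i : I, omits M (X i)].
Proof.
have n_gt0 : 0 < n by apply: leq_trans hn.
have [_ [M0 M0T] _] := hT.
have qe : structure_qe 'I_n M0 := qe_Ln n_gt0 hQE M0T.
have [task_of task_ofP] := enumerate_tasks n hS.
have [chi [chi_con chi_dec chi_wit chi_sep]] :=
  fusion qe task_of (carrier_inhabited M0).
have chi_mono f j k : j <= k -> sols M0 (chi f k) `<=` sols M0 (chi f j).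
  move=> /subnK <-; elim: (k - j) => [|m IH] //.
  by rewrite addSn; apply: subset_trans (chi_dec _ _) IH.
pose H f : set (set (nat -> M0)) := [set P | exists k, sols M0 (chi f k) `<=` P].
have HH f : henkin_filter (H f).
  split=> [|P Q PQ [k hk]|P Q [j hj] [k hk]|[k hk]|theta x qf].
  - by exists 0.
  - by exists k; apply: subset_trans PQ.
  - exists (maxn j k) => w hw.
    by split; [apply: hj|apply: hk]; apply: chi_mono hw; rewrite ?leq_maxl ?leq_maxr.
  - by have [w /hk] := chi_con f k.
  - have [j jE] := task_ofP (theta, x, ([ffun=> 0], [ffun=> 0])).
    have := chi_wit f j; rewrite jE => /(_ qf) [h|[y h]]; [left|right; exists y];
    by exists j.+1.
have model f : exists Ne : {N : structure S & nat -> N},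
    (forall b, exists x, projT2 Ne x = b) /\
    forall (phi : formula S 'I_n) (r : 'I_n -> nat),
      sat (projT2 Ne \o r) phi <-> H f [set w : nat -> M0 | sat (w \o r) phi].
  by have [N [el elP]] := henkin_model_exists (HH f) qe; exists (existT _ N el).
have [Ne elP] := choice model.
pose N f := projT1 (Ne f); pose el f : nat -> N f := projT2 (Ne f).
have el_sat f phi (r : 'I_n -> nat) :
    sat (el f \o r) phi <-> H f [set w : nat -> M0 | sat (w \o r) phi] := (elP f).2 phi r.
have names f (s : 'I_n -> N f) : exists u : {ffun 'I_n -> nat}, el f \o u = s.
  have [u uP] := choice (fun i => (elP f).1 (s i)).
  by exists (finfun u); apply/funext => i; rewrite /= ffunE; apply: uP.
have NT f : models (N f) T.
  move=> phi Tphi s; have [u <-] := names f s.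
  by apply/el_sat; exists 0 => w _; apply: M0T.
have forced f k phi (u : 'I_n -> nat) :
    sols M0 (chi f k) `<=` [set w : nat -> M0 | sat (w \o u) phi] ->
    sat (el f \o u) phi by move=> h; apply/el_sat; exists k.
suff [f fP] : exists f, forall i, omits (N f) (X i).
  exists (N f); split=> //.
  have -> : [set: N f] = el f @` [set: nat].
    by apply/seteqP; split=> // b _; have [x <-] := (elP f).1 b; exists x.
  exact: sub_countable (card_image_le _ _) (countableP _).
apply: contrapT => none.
have realized f : exists i, exists s : 'I_n -> N f, forall phi, X i phi -> sat s phi.
  apply: contrapT => h; apply: none; exists f => i [s hs].
  by apply: h; exists i, s.
have [F FP] := choice realized.
have F_inj : injective F.
  move=> f g Ffg; apply: contrapT => fg.
  have [s hs] := FP f; have [t ht] := FP g; rewrite -Ffg in ht.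
  have [u us] := names f s; have [v vt] := names g t.
  have [j jE] := task_ofP (Bot, 0, (u, v)).
  have [m fgm] : exists m, f m <> g m.
    by apply: contrapT => h; apply: fg; apply/funext => m; apply: contrapT => fgm;
       apply: h; exists m.
  pose k := maxn j m; rewrite -us in hs; rewrite -vt in ht.
  have bfg : branch f k.+1 <> branch g k.+1.
    by move/branch_eq => /(_ m); rewrite ltnS leq_maxr => /(_ isT).
  have [cX npX] := hX (F f).
  have := chi_sep f g j k.+1; rewrite ltnS leq_maxl jE => /(_ isT bfg) /= [iso|].
    apply: (isolated_realization_principal n_gt0 hT hQE M0T (chi_con f k.+1) iso _ hs npX).
    by move=> phi; apply: forced.
  case=> phi [/forced phif /(forced g _ (Not phi)) phig].
  have [psi [Xpsi [pos|neg]]] := complete_type_decides phi cX.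
    exact: phig (pos _ _ (NT g) (ht _ Xpsi)).
  exact: (neg _ _ (NT f) (hs _ Xpsi)).
case/andP: hI => _ /negP; apply.
(* [F] is an injection of the power set of the natural numbers into [I], which
   [hI] rules out. *)
pose G (A : set nat) := F (fun m => `[< A m >]).
apply: (@card_ge_preimage _ _ [set: I] G) => A B _ _ /F_inj AB.
by apply/funext => m; apply/propext; apply: asbool_eq_equiv; apply: (congr1 (@^~ m) AB).
Qed.
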